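(* Among the six patterns in $\mathfrak{S}_3$ (each regarded as a singleton pattern set), the $\mathrm{bdes}$-Wilf equivalence classes are exactly the following four: $\{231,312\}$, $\{132,213\}$, $\{123\}$, and $\{321\}$. In particular, there are no non-trivial $\mathrm{bdes}$-Wilf equivalences among these patterns.
   Context: $\mathfrak{S}_n$ is the set of permutations $\pi=\pi_1\pi_2\cdots\pi_n$ of $[n]=\{1,\dots,n\}$ in one-line notation ($\mathfrak{S}_0$ consists of the empty permutation). A permutation $\pi$ avoids $\sigma\in\mathfrak{S}_k$ if no subsequence of $\pi$ of length $k$ has the same relative order as $\sigma$. For a set $\Pi$ of patterns, $\mathfrak{S}_n(\Pi)$ is the set of permutations in $\mathfrak{S}_n$ avoiding every pattern in $\Pi$. An index $k\in[n-1]$ is a big descent of $\pi\in\mathfrak{S}_n$ if $\pi_k>\pi_{k+1}+1$; $\mathrm{bdes}(\pi)$ is the number of big descents of $\pi$. Two pattern sets $\Pi,\Pi'$ are $\mathrm{bdes}$-Wilf equivalent if $\sum_{\pi\in\mathfrak{S}_n(\Pi)}t^{\mathrm{bdes}(\pi)}=\sum_{\pi\in\mathfrak{S}_n(\Pi')}t^{\mathrm{bdes}(\pi)}$ for all $n\ge 0$. The reverse-complement of $\pi\in\mathfrak{S}_n$ is $\pi^{rc}=(n+1-\pi_n)(n+1-\pi_{n-1})\cdots(n+1-\pi_1)$, and $\Pi^{rc}=\{\pi^{rc}:\pi\in\Pi\}$; equivalences between $\Pi$ and $\Pi^{rc}$ (or of $\Pi$ with itself) are called trivial. *)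

(* Defs.v *)
From mathcomp Require Import all_boot all_order all_algebra all_fingroup.
From mathcomp Require Import boolp classical_sets.
Set Implicit Arguments.
Unset Strict Implicit.
Unset Printing Implicit Defensive.
Import GRing.Theory.

(* The index set [n] is 'I_n, so positions and values of pi : 'S_n are shifted
   by one; [one_line] restores the usual values 1, ..., n. *)
Definition one_line n (pi : 'S_n) : seq nat := [seq (pi i : nat).+1 | i : 'I_n].

(* The permutations whose one-line notation is listed in ws. *)
Definition perms_of_words n (ws : seq (seq nat)) : {set 'S_n} :=
  [set pi : 'S_n | one_line pi \in ws].

(* f gives the positions of the subsequence, in increasing order. *)
Definition contains n k (pi : 'S_n) (sigma : 'S_k) : bool :=
  [exists f : {ffun 'I_k -> 'I_n},
    [forall i : 'I_k, forall j : 'I_k,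
      ((i < j) ==> (f i < f j)) && ((pi (f i) < pi (f j)) == (sigma i < sigma j))]].

Definition avoids n k (pi : 'S_n) (sigma : 'S_k) : bool := ~~ contains pi sigma.

(* A pattern is a permutation of any length; pattern sets may be infinite and
   may mix lengths. *)
Definition pattern : Type := {k : nat & 'S_k}.

Definition mk_pattern k (sigma : 'S_k) : pattern := existT (fun k => 'S_k) k sigma.

Definition avoiders n (Pi : set pattern) : {set 'S_n} :=
  [set pi : 'S_n | `[< forall p : pattern, Pi p -> avoids pi (projT2 p) >]].

(* k : 'I_n.-1 is the position k + 1 in {1, ..., n - 1}. *)
Definition big_descents n (pi : 'S_n) : {set 'I_n.-1} :=
  [set k : 'I_n.-1 | nth 0 (one_line pi) k > nth 0 (one_line pi) k.+1 + 1].

Definition bdes n (pi : 'S_n) : nat := #|big_descents pi|.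

Definition bdes_poly n (Pi : set pattern) : {poly int} :=
  (\sum_(pi in avoiders n Pi) 'X^(bdes pi))%R.

Definition bdes_Wilf (Pi Pi' : set pattern) : Prop :=
  forall n : nat, bdes_poly n Pi = bdes_poly n Pi'.

Lemma rc_fun_inj n (pi : 'S_n) : injective (fun i : 'I_n => rev_ord (pi (rev_ord i))).
Proof. by move=> i j /rev_ord_inj /perm_inj /rev_ord_inj. Qed.

Definition rc n (pi : 'S_n) : 'S_n := perm (@rc_fun_inj n pi).

Definition rc_set (Pi : set pattern) : set pattern :=
  [set mk_pattern (rc (projT2 p)) | p in Pi]%classic.

Definition trivially_related (Pi Pi' : set pattern) : Prop :=
  Pi' = Pi \/ Pi' = rc_set Pi.

Definition single k (sigma : 'S_k) : set pattern := [set mk_pattern sigma]%classic.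

Definition bdes_Wilf_classes k : {set {set 'S_k}} :=
  equivalence_partition
    (fun sigma tau : 'S_k => `[< bdes_Wilf (single sigma) (single tau) >])
    [set: 'S_k].

(* Main.v *)
(* Reverse-complementation preserves both pattern containment and big descents,
   which gives the two non-singleton classes. Conversely, the value at t = 2 of
   the polynomial for n = 4 is 28 for 123, 26 for 132 and 213, 20 for 231 and
   312, and 25 for 321, so it separates the four classes. *)
Require Import Defs.
From mathcomp Require Import all_boot all_order all_algebra all_fingroup.
From mathcomp Require Import boolp classical_sets.
From mathcomp Require Import zify.
Set Implicit Arguments.
Unset Strict Implicit.
Unset Printing Implicit Defensive.
Import GRing.Theory Num.Theory.

Lemma rcE n (pi : 'S_n) i : rc pi i = rev_ord (pi (rev_ord i)).
Proof. by rewrite permE. Qed.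

Lemma rcK n : involutive (@rc n).
Proof. by move=> pi; apply/permP=> i; rewrite !rcE !rev_ordK. Qed.

Lemma ltn_rev_ord n (i j : 'I_n) : (rev_ord i < rev_ord j) = (j < i).
Proof. by rewrite /= ltn_sub2lE ?ltnS // ltn_ord. Qed.

(** Conjugating an occurrence by [rev_ord] reverses positions and values alike, so each comparison
    of [i] with [j] becomes the original one of [rev_ord j] with [rev_ord i]. *)
Lemma contains_rc_imp n k (pi : 'S_n) (sigma : 'S_k) :
  contains pi sigma -> contains (rc pi) (rc sigma).
Proof.
move=> /existsP[f /forallP fP].
apply/existsP; exists [ffun i => rev_ord (f (rev_ord i))].
apply/forallP=> i; apply/forallP=> j.
have /forallP/(_ (rev_ord i))/andP[fij /eqP pij] := fP (rev_ord j).
rewrite !ffunE !rcE !rev_ordK !ltn_rev_ord pij eqxx andbT.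
by rewrite ltn_rev_ord in fij.
Qed.

Lemma avoids_rc n k (pi : 'S_n) (sigma : 'S_k) :
  avoids (rc pi) (rc sigma) = avoids pi sigma.
Proof.
congr (~~ _); apply/idP/idP; last exact: contains_rc_imp.
by move=> /contains_rc_imp; rewrite !rcK.
Qed.

Lemma size_one_line n (pi : 'S_n) : size (one_line pi) = n.
Proof. by rewrite size_map size_enum_ord. Qed.

Lemma nth_one_line n (pi : 'S_n) (i : 'I_n) :
  nth 0 (one_line pi) i = (pi i).+1.
Proof. by rewrite (nth_map i) ?size_enum_ord // nth_ord_enum. Qed.

Lemma nth_one_line_lt n (pi : 'S_n) i (ltin : i < n) :
  nth 0 (one_line pi) i = (pi (Ordinal ltin)).+1.
Proof. by rewrite -nth_one_line. Qed.

Lemma one_line_rc n (pi : 'S_n) :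
  one_line (rc pi) = rev [seq n.+1 - x | x <- one_line pi].
Proof.
apply: (@eq_from_nth _ 0) => [|i].
  by rewrite size_rev size_map !size_one_line.
rewrite size_one_line => ltin.
rewrite (nth_one_line_lt _ ltin) nth_rev size_map size_one_line //.
rewrite (nth_map 0) ?size_one_line ?rev_ord_proof //; last first.
  by rewrite ltn_subrL (leq_ltn_trans _ ltin).
by rewrite (nth_one_line pi (rev_ord (Ordinal ltin))) rcE /= subSn.
Qed.

(** Adjacent positions stay adjacent in reversed order and complementation reverses their values
    again, so the size of each drop is kept; the descent at [k] moves to [rev_ord k]. *)
Lemma bdes_rc n (pi : 'S_n) : bdes (rc pi) = bdes pi.
Proof.
rewrite /bdes -(card_imset _ (@rev_ord_inj n.-1)).
congr #|pred_of_set _|; apply/setP=> k.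
rewrite -[k in LHS]rev_ordK mem_imset; last exact: rev_ord_inj.
case: n pi k => [|n] pi k; first by case: k.
rewrite !inE.
have k1 : k.+1 < n.+1 := ltn_ord k.
have k0 : k < n.+1 := ltnW k1.
have r1 : (rev_ord k).+1 < n.+1 := ltn_ord (rev_ord k).
have r0 : rev_ord k < n.+1 := ltnW r1.
rewrite (nth_one_line_lt _ k0) (nth_one_line_lt _ k1).
rewrite (nth_one_line_lt _ r0) (nth_one_line_lt _ r1) !rcE.
(* The inner [rev_ord] acts on ['I_n], the outer one on ['I_n.+1]; this off-by-one swaps the two
   ends of the pair [k], [k.+1]. *)
have -> : rev_ord (Ordinal r0) = Ordinal k1.
  by apply: val_inj; move: (k1) => /=; lia.
have -> : rev_ord (Ordinal r1) = Ordinal k0.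
  by apply: val_inj; move: (k1) => /=; lia.
have := ltn_ord (pi (Ordinal k0)); have := ltn_ord (pi (Ordinal k1)).
by rewrite /=; lia.
Qed.

Lemma bdes_Wilf_rc (Pi : set pattern) : bdes_Wilf Pi (rc_set Pi).
Proof.
move=> n; rewrite /bdes_poly [RHS](reindex_inj (inv_inj (@rcK n))) /=.
apply: eq_big => pi; last by rewrite bdes_rc.
rewrite !inE; apply: asbool_equiv_eq; split=> [avPi _ [p Pip <-]|avPi p Pip].
  by rewrite avoids_rc; exact: avPi p Pip.
by rewrite -avoids_rc; apply: (avPi (mk_pattern _)); exists p.
Qed.

Lemma rc_set_single k (sigma : 'S_k) :
  rc_set (single sigma) = single (rc sigma).
Proof. exact: image_set1. Qed.

Lemma one_line_inj n : injective (@one_line n).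
Proof.
move=> s t st; apply/permP=> i; apply/val_inj/succn_inj.
by rewrite -!nth_one_line st.
Qed.

Lemma perm_one_line n (pi : 'S_n) : perm_eq (one_line pi) (iota 1 n).
Proof.
have u : uniq (one_line pi).
  by rewrite map_inj_uniq ?enum_uniq // => i j [/val_inj/perm_inj].
apply: (uniq_perm u (iota_uniq _ _)).
apply: (uniq_min_size u _ _).2 => [x /mapP[i _ ->]|].
  by rewrite mem_iota; exact: ltn_ord.
by rewrite size_iota size_one_line.
Qed.

(** Turns sums over ['S_n] into sums over an explicit list. The words are distinct and [n]! in
    number, hence exhaust the [n]! rearrangements. *)
Lemma perm_one_line_enum n :
  perm_eq [seq one_line pi | pi : 'S_n] (permutations (iota 1 n)).
Proof.
have u : uniq [seq one_line pi | pi : 'S_n].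
  by rewrite map_inj_uniq ?enum_uniq //; apply: one_line_inj.
apply: (uniq_perm u (permutations_uniq _)).
apply: (uniq_min_size u _ _).2 => [w /mapP[pi _ ->]|].
  by rewrite mem_permutations perm_one_line.
rewrite size_permutations ?iota_uniq // size_iota size_map -cardE.
by rewrite card_Sn.
Qed.

Lemma one_line_mem n (pi : 'S_n) : one_line pi \in permutations (iota 1 n).
Proof. by rewrite mem_permutations perm_one_line. Qed.

Lemma one_line_surj n w :
  w \in permutations (iota 1 n) -> exists pi : 'S_n, one_line pi = w.
Proof.
by rewrite -(perm_mem (perm_one_line_enum n)) => /mapP[pi _ ->]; exists pi.
Qed.

(** List form of the functions from ['I_k] to ['I_n], so that the search for an occurrence can be
    run by evaluation. *)
Fixpoint words k n : seq (seq nat) :=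
  if k is k'.+1 then [seq x :: w | x <- iota 0 n, w <- words k' n] else [:: [::]].

Lemma mem_words k n w : (w \in words k n) = (size w == k) && all (gtn n) w.
Proof.
elim: k w => [|k IHk] [|x w] //=.
  by apply/negbTE/allpairsPdep=> -[? [? []]].
rewrite eqSS andbCA -IHk.
apply/allpairsPdep/andP => [[y [v [yn vw [-> ->]]]]|[xn wk]].
  by rewrite mem_iota in yn.
by exists x, w; rewrite mem_iota.
Qed.

Definition word_contains (w s : seq nat) : bool :=
  has (fun g => all (fun i => all (fun j =>
      ((i < j) ==> (nth 0 g i < nth 0 g j)) &&
      ((nth 0 w (nth 0 g i) < nth 0 w (nth 0 g j)) == (nth 0 s i < nth 0 s j)))
    (iota 0 (size s))) (iota 0 (size s)))
  (words (size s) (size w)).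

Lemma containsE n k (pi : 'S_n) (sigma : 'S_k) :
  contains pi sigma = word_contains (one_line pi) (one_line sigma).
Proof.
rewrite /word_contains !size_one_line.
apply/existsP/hasP => [[f /forallP fP]|[g]].
  have nth_f (i : 'I_k) : nth 0 [seq val (f i) | i : 'I_k] i = f i.
    by rewrite (nth_map i) ?size_enum_ord // nth_ord_enum.
  exists [seq val (f i) | i : 'I_k].
    rewrite mem_words size_map size_enum_ord eqxx /=.
    by apply/allP=> _ /mapP[i _ ->]; apply: ltn_ord.
  apply/allP=> i; rewrite mem_iota => lti; apply/allP=> j; rewrite mem_iota => ltj.
  have /forallP/(_ (Ordinal ltj)) := fP (Ordinal lti).
  (* One-line values carry a successor on both sides of each comparison, so the shift cancels. *)
  rewrite (nth_f (Ordinal lti)) (nth_f (Ordinal ltj)) !nth_one_line.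
  by rewrite (nth_one_line_lt _ lti) (nth_one_line_lt _ ltj).
rewrite mem_words => /andP[/eqP sg /allP gn] /allP gP.
have ltg (i : 'I_k) : nth 0 g i < n by apply: gn; rewrite mem_nth ?sg.
exists [ffun i => Ordinal (ltg i)].
apply/forallP=> i; apply/forallP=> j; rewrite !ffunE.
have it (l : 'I_k) : val l \in iota 0 k by rewrite mem_iota ltn_ord.
have /allP/(_ _ (it j)) := gP _ (it i).
rewrite (nth_one_line_lt _ (ltg i)) (nth_one_line_lt _ (ltg j)).
by rewrite !nth_one_line.
Qed.

Definition word_bdes (w : seq nat) : nat :=
  count (fun k => nth 0 w k > nth 0 w k.+1 + 1) (iota 0 (size w).-1).

Lemma bdesE n (pi : 'S_n) : bdes pi = word_bdes (one_line pi).
Proof.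
rewrite /bdes /word_bdes size_one_line -val_enum_ord count_map.
by rewrite cardsE cardE -size_filter enumT.
Qed.

(** The polynomial at t = 2 in a form that evaluates. At t = 1 it would only count avoiders, and
    that count is the same for all six patterns. *)
Definition word_bdes_at2 n (s : seq nat) : nat :=
  sumn [seq 2 ^ word_bdes w | w <- permutations (iota 1 n) & ~~ word_contains w s].

Lemma bdes_poly_at2 n k (sigma : 'S_k) :
  (bdes_poly n (single sigma)).[2]%R = (word_bdes_at2 n (one_line sigma))%:R%R.
Proof.
rewrite /bdes_poly horner_sum /word_bdes_at2 sumnE big_map big_filter.
rewrite -(perm_big _ (perm_one_line_enum n)) /= big_map big_enum_cond natr_sum.
apply: eq_big => [pi|pi _]; last by rewrite hornerXn bdesE natrX.
rewrite inE -containsE; apply/asboolP/idP => [|av _ ->] //.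
exact: (fun H => H (mk_pattern sigma) erefl).
Qed.

Lemma bdes_Wilf_at2 k l (sigma : 'S_k) (tau : 'S_l) n :
  bdes_Wilf (single sigma) (single tau) ->
  word_bdes_at2 n (one_line sigma) = word_bdes_at2 n (one_line tau).
Proof.
by move=> /(_ n) e; apply/eqP; rewrite -(eqr_nat int) -!bdes_poly_at2 e.
Qed.

Lemma eq_at2_rc (sigma tau : 'S_3) :
  word_bdes_at2 4 (one_line sigma) = word_bdes_at2 4 (one_line tau) ->
  tau = sigma \/ tau = rc sigma.
Proof.
(* All 36 pairs of words are checked. The 4 in [4 - x] is n + 1 for patterns of length n = 3; the 4
   in [word_bdes_at2 4] is the length of the avoiders. *)
have H : all (fun s => all (fun t =>
    (word_bdes_at2 4 s == word_bdes_at2 4 t) ==>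
      (t == s) || (t == rev [seq 4 - x | x <- s]))
    (permutations (iota 1 3))) (permutations (iota 1 3)).
  by vm_compute.
have /allP/(_ _ (one_line_mem tau)) := allP H _ (one_line_mem sigma).
move=> /implyP/[swap] /eqP/[swap]/[apply].
by rewrite -one_line_rc !(inj_eq (@one_line_inj _)) => /orP[]/eqP; [left|right].
Qed.

(** One number decides equality for every length: agreement at length 4 already forces a trivial
    relation, and trivial relations are equivalences. *)
Lemma bdes_WilfE (sigma tau : 'S_3) :
  `[< bdes_Wilf (single sigma) (single tau) >] =
  (word_bdes_at2 4 (one_line sigma) == word_bdes_at2 4 (one_line tau)).
Proof.
apply/asboolP/eqP => [|/eq_at2_rc[]->]; first exact: bdes_Wilf_at2.
  by [].
by rewrite -rc_set_single; apply: bdes_Wilf_rc.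
Qed.

(** Recognises a listed class as a level set of the numerical invariant, by a check on six words. *)
Lemma perms_of_words_at2 v ws :
  all (fun w => (w \in ws) == (v == word_bdes_at2 4 w)) (permutations (iota 1 3)) ->
  perms_of_words 3 ws = [set sigma | v == word_bdes_at2 4 (one_line sigma)].
Proof.
by move=> /allP H; apply/setP=> s; rewrite !inE (eqP (H _ (one_line_mem s))).
Qed.

Theorem theorem1p1 :
  bdes_Wilf_classes 3 =
    [set perms_of_words 3 [:: [:: 2; 3; 1]; [:: 3; 1; 2]];
         perms_of_words 3 [:: [:: 1; 3; 2]; [:: 2; 1; 3]];
         perms_of_words 3 [:: [:: 1; 2; 3]];
         perms_of_words 3 [:: [:: 3; 2; 1]]]
  /\ (forall sigma tau : 'S_3,
        bdes_Wilf (single sigma) (single tau) ->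
        trivially_related (single sigma) (single tau)).
Proof.
split; last first.
  move=> sigma tau /(@bdes_Wilf_at2 _ _ _ _ 4)/eq_at2_rc[]->; first by left.
  by right; rewrite rc_set_single.
pose C v := [set sigma : 'S_3 | v == word_bdes_at2 4 (one_line sigma)].
rewrite (@perms_of_words_at2 20 [:: [:: 2; 3; 1]; [:: 3; 1; 2]]); last by vm_compute.
rewrite (@perms_of_words_at2 26 [:: [:: 1; 3; 2]; [:: 2; 1; 3]]); last by vm_compute.
rewrite (@perms_of_words_at2 28 [:: [:: 1; 2; 3]]); last by vm_compute.
rewrite (@perms_of_words_at2 25 [:: [:: 3; 2; 1]]); last by vm_compute.
(* Since the relation is equality of an invariant, its classes are the fibres [C v] over the
   attained values. *)
have -> : bdes_Wilf_classes 3 =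
    [set C (word_bdes_at2 4 (one_line sigma)) | sigma in [set: 'S_3]].
  by apply: eq_imset => s; apply/setP=> t; rewrite !inE bdes_WilfE.
(* No fifth class: only these four values occur. *)
have vals : all (fun w => word_bdes_at2 4 w \in [:: 20; 26; 28; 25])
    (permutations (iota 1 3)) by vm_compute.
(* Conversely, each of the four fibres is a class as soon as some word attains its value; one word
   per fibre is supplied at the end, its value being found by conversion. *)
have rep w : w \in permutations (iota 1 3) ->
    C (word_bdes_at2 4 w) \in
      [set C (word_bdes_at2 4 (one_line sigma)) | sigma in [set: 'S_3]].
  by move=> /one_line_surj[s <-]; apply: imset_f.
apply/setP=> S; rewrite !inE; apply/imsetP/idP.
  move=> [s _ ->]; have := allP vals _ (one_line_mem s); rewrite !inE.
  by case/or4P=> /eqP->; rewrite eqxx ?orbT.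
move=> SP; apply/imsetP; move: SP; rewrite -!orbA.
case/or4P=> /eqP->.
- by apply: (rep [:: 2; 3; 1]).
- by apply: (rep [:: 1; 3; 2]).
- by apply: (rep [:: 1; 2; 3]).
- by apply: (rep [:: 3; 2; 1]).
Qed.
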